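(* The set $\mathcal{F}_{K_4}$ has infinitely many non-isomorphic graphs.
   Context: Graphs are finite, without loops or multiple edges. For a vertex $u$ of a graph $G$, the local complementation $G*u$ is obtained from $G$ by complementing the adjacency between every pair of distinct neighbours of $u$. For an edge $uv$ of $G$, the edge pivot is $G\wedge uv=((G*u)*v)*u$. A graph $G$ contains $H$ as a pivot-minor if $H$ can be obtained from $G$ by a sequence of vertex deletions and edge pivots. For a graph $H$, $\mathcal{F}_H$ is the set of induced-subgraph-minimal graphs containing a pivot-minor isomorphic to $H$: a graph $F$ is in $\mathcal{F}_H$ if and only if $F$ contains a pivot-minor isomorphic to $H$ but no proper induced subgraph of $F$ does. $K_4$ is the complete graph on four vertices. *)

(* Defs.v *)
From mathcomp Require Import all_boot.
Set Implicit Arguments.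
Unset Strict Implicit.
Unset Printing Implicit Defensive.

Record sgraph := SGraph {
  vertex :> finType;
  adj : rel vertex;
  adj_sym : symmetric adj;
  adj_irr : irreflexive adj
}.

Definition isomorphic (G H : sgraph) : Prop :=
  exists2 f : G -> H, bijective f & {mono f : x y / adj x y}.

Section Constructions.
Variable G : sgraph.

Definition induced_adj (S : {set G}) : rel {x : G | x \in S} :=
  fun x y => adj (val x) (val y).

Lemma induced_adj_sym S : symmetric (@induced_adj S).
Proof. by move=> x y; apply: adj_sym. Qed.

Lemma induced_adj_irr S : irreflexive (@induced_adj S).
Proof. by move=> x; apply: adj_irr. Qed.

Definition induced (S : {set G}) : sgraph :=
  SGraph (@induced_adj_sym S) (@induced_adj_irr S).

Definition delete_vertex (v : G) : sgraph := induced [set~ v].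

Definition local_compl_adj (u : G) : rel G :=
  fun x y => adj x y (+) [&& x != y, adj u x & adj u y].

Lemma local_compl_adj_sym u : symmetric (local_compl_adj u).
Proof.
by move=> x y; rewrite /local_compl_adj adj_sym eq_sym [adj u x && _]andbC.
Qed.

Lemma local_compl_adj_irr u : irreflexive (local_compl_adj u).
Proof. by move=> x; rewrite /local_compl_adj adj_irr eqxx. Qed.

Definition local_compl (u : G) : sgraph :=
  SGraph (local_compl_adj_sym u) (local_compl_adj_irr u).

End Constructions.

(* Meaningful only when [adj u v]; this is required wherever it is used. *)
Definition edge_pivot (G : sgraph) (u v : G) : sgraph :=
  @local_compl (@local_compl (@local_compl G u) v) u.

(* [pivot_reachable G G'] : the graph [G'] itself, not just up to isomorphism,
   results from [G] by a finite sequence of vertex deletions and edge pivots. *)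
Inductive pivot_reachable : sgraph -> sgraph -> Prop :=
| pivot_reachable_refl (G : sgraph) : pivot_reachable G G
| pivot_reachable_delete (G : sgraph) (v : G) G' :
    pivot_reachable (delete_vertex v) G' -> pivot_reachable G G'
| pivot_reachable_pivot (G : sgraph) (u v : G) G' :
    adj u v -> pivot_reachable (edge_pivot u v) G' -> pivot_reachable G G'.

Definition has_pivot_minor (G H : sgraph) : Prop :=
  exists2 G', pivot_reachable G G' & isomorphic G' H.

Definition minimal_family (H F : sgraph) : Prop :=
  has_pivot_minor F H /\
  forall S : {set F}, S \proper [set: F] -> ~ has_pivot_minor (induced S) H.

Definition complete_adj n : rel 'I_n := fun x y => x != y.

Lemma complete_adj_sym n : symmetric (@complete_adj n).
Proof. by move=> x y; rewrite /complete_adj eq_sym. Qed.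

Lemma complete_adj_irr n : irreflexive (@complete_adj n).
Proof. by move=> x; rewrite /complete_adj eqxx. Qed.

Definition complete_graph (n : nat) : sgraph :=
  SGraph (@complete_adj_sym n) (@complete_adj_irr n).

Definition infinitely_many_nonisomorphic (P : sgraph -> Prop) : Prop :=
  exists F : nat -> sgraph,
    (forall i, P (F i)) /\ (forall i j, i <> j -> ~ isomorphic (F i) (F j)).

(* Main.v *)
(** Call a vertex set X feasible when the adjacency matrix restricted to X is
    nonsingular over GF(2).  Pivoting an edge uv replaces every feasible set by
    its symmetric difference with {u, v}, so a K_4 pivot-minor of G yields X and
    a 4-set Y such that X + Z is feasible for every even subset Z of Y.  In a
    bipartite graph feasible sets meet both colour classes equally, and at most
    two elements can be toggled in pairs without breaking this balance.

    The witnesses are the odd cycles with one vertex replaced by true twins.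
    Pivoting shortens such a cycle by two until it becomes K_4.  Conversely,
    every proper induced subgraph is contained either in an odd cycle, which is
    bipartite after removing an element of Y, or in a path with one vertex
    twinned; there, either some twin can be removed, or both twins lie in X, and
    then they can be toggled together since pivoting two true twins does not
    change the graph. *)

Require Import Defs.
From mathcomp Require Import all_boot.
From mathcomp Require Import zify.

Set Implicit Arguments.
Unset Strict Implicit.
Unset Printing Implicit Defensive.

(** * Symmetric differences of finite sets *)

Section SymmetricDifference.
Variable T : finType.
Implicit Types (A B C : {set T}) (x y : T).

Definition symdiff A B := [set x | (x \in A) (+) (x \in B)].

Lemma in_symdiff A B x : (x \in symdiff A B) = (x \in A) (+) (x \in B).
Proof. by rewrite inE. Qed.

Lemma symdiff0 A : symdiff A set0 = A.
Proof. by apply/setP=> x; rewrite !inE addbF. Qed.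

Lemma symdiffA A B C : symdiff A (symdiff B C) = symdiff (symdiff A B) C.
Proof. by apply/setP=> x; rewrite !inE addbA. Qed.

Lemma symdiffC A B : symdiff A B = symdiff B A.
Proof. by apply/setP=> x; rewrite !inE addbC. Qed.

Lemma symdiffAC A B C : symdiff (symdiff A B) C = symdiff (symdiff A C) B.
Proof. by rewrite -!symdiffA (symdiffC B). Qed.

Lemma symdiffK A B : symdiff (symdiff A B) B = A.
Proof. by apply/setP=> x; rewrite !inE addbK. Qed.

Lemma symdiff_sub A B C : A \subset C -> B \subset C -> symdiff A B \subset C.
Proof.
move=> /subsetP sAC /subsetP sBC; apply/subsetP=> x; rewrite inE.
by case: (boolP (x \in A)) => [/sAC|_ /sBC].
Qed.

Lemma set2_sub C x y : x \in C -> y \in C -> [set x; y] \subset C.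
Proof. by move=> xC yC; rewrite subUset !sub1set xC. Qed.

Lemma card_symdiff1 A x :
  #|symdiff A [set x]| + (x \in A) = #|A| + (x \notin A).
Proof.
case: (boolP (x \in A)) => xA.
  have -> : symdiff A [set x] = A :\ x.
    by apply/setP=> y; rewrite !inE; case: eqVneq => [->|]; rewrite ?xA // addbF.
  by rewrite (cardsD1 x A) xA /=; lia.
have -> : symdiff A [set x] = x |: A.
  apply/setP=> y; rewrite !inE; case: eqVneq => [->|]; last by rewrite addbF.
  by rewrite (negPf xA).
by rewrite cardsU1 xA /=; lia.
Qed.

Lemma symdiff_set2 A x y : x != y ->
  symdiff A [set x; y] = symdiff (symdiff A [set x]) [set y].
Proof.
move=> xy; rewrite -symdiffA; congr symdiff; apply/setP=> z; rewrite !inE.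
by case: (eqVneq z x) => [->|]; rewrite ?(negPf xy).
Qed.

Lemma card_symdiff2 A x y : x != y ->
  #|symdiff A [set x; y]| + (x \in A) + (y \in A)
    = #|A| + (x \notin A) + (y \notin A).
Proof.
move=> xy; rewrite symdiff_set2 //.
have := card_symdiff1 (symdiff A [set x]) y; have := card_symdiff1 A x.
by rewrite !inE eq_sym (negPf xy) addbF; lia.
Qed.

Lemma odd_symdiff2 A x y : x != y -> odd #|symdiff A [set x; y]| = odd #|A|.
Proof. by move=> /(card_symdiff2 A); lia. Qed.

End SymmetricDifference.

Lemma imset_symdiff (S T : finType) (f : S -> T) (A B : {set S}) :
  injective f -> f @: symdiff A B = symdiff (f @: A) (f @: B).
Proof.
move=> f_inj; apply/setP=> y; rewrite inE.
case: (boolP (y \in codom f)) => [/codomP [x ->]|yNf].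
  by rewrite !mem_imset // inE.
have notin (C : {set S}) : (y \in f @: C) = false.
  by apply: contraNF yNf => /imsetP [x _ ->]; apply: codom_f.
by rewrite !notin.
Qed.

(** * Feasible sets and their behaviour under pivoting *)

Section Feasible.
Variable G : sgraph.
Implicit Types (W X : {set G}) (x y u v : G).

(** Coordinate [x] of the adjacency matrix applied, over GF(2), to the indicator vector of [W]. *)
Definition par W x := \big[addb/false]_y ((y \in W) && adj x y).

(* The adjacency matrix restricted to [X] is nonsingular over GF(2), subsets
   [W] of [X] standing for vectors. *)
Definition feasible X : Prop :=
  forall W, W \subset X -> (forall x, x \in X -> ~~ par W x) -> W = set0.

Lemma feasible0 : feasible set0.
Proof. by move=> W; rewrite subset0 => /eqP. Qed.

Lemma par_symdiff W1 W2 x : par (symdiff W1 W2) x = par W1 x (+) par W2 x.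
Proof.
rewrite /par -big_split; apply: eq_bigr => y _ /=.
by rewrite inE; case: (y \in W1); case: (y \in W2); case: (adj x y).
Qed.

(** The three local complementations amount to a principal pivot of the adjacency matrix: [u] and
    [v] exchange their other neighbours, and the last line is the Schur complement of the block on
    [u] and [v]. *)
Lemma edge_pivotE u v x y : adj u v -> @adj (edge_pivot u v) x y =
  if x == y then false else
  if x == u then (if y == v then true else adj v y) else
  if x == v then (if y == u then true else adj u y) else
  if y == u then adj x v else if y == v then adj x u else
  adj x y (+) (adj x u && adj v y) (+) (adj x v && adj u y).
Proof.
move=> uv; do 3!rewrite /= /local_compl_adj; rewrite /=.
have vu : adj v u by rewrite adj_sym.
have uNv : u != v by apply: contraTneq uv => ->; rewrite adj_irr.
have neqE (a b : G) : a != b -> ((a == b) = false) * ((b == a) = false).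
  by move=> /negPf ab; rewrite [b == a]eq_sym ab.
have uvE := neqE _ _ uNv.
have [->|xNy] := eqVneq x y; first by rewrite adj_irr.
have xyE := neqE _ _ xNy.
have [xu|/neqE xuE] := eqVneq x u; [|have [xv|/neqE xvE] := eqVneq x v];
(have [yu|/neqE yuE] := eqVneq y u; [|have [yv|/neqE yvE] := eqVneq y v]).
all: do ?[subst x]; do ?[subst y]; try by rewrite eqxx in xNy.
all: rewrite ?(adj_sym _ u) ?(adj_sym _ v).
all: rewrite ?eqxx ?adj_irr ?uv ?vu ?uvE ?xyE ?xuE ?xvE ?yuE ?yvE ?andbT ?andbF //=.
all: try by case: (adj x y); case: (adj u x); case: (adj v x); case: (adj u y); case: (adj v y).
all: try by case: (adj u x); case: (adj v x).
all: try by case: (adj u y); case: (adj v y).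
Qed.

(** Exchanging equal neighbourhoods has no effect, and the two correction terms in [edge_pivotE]
    cancel. *)
Lemma true_twin_pivot u v x y : adj u v ->
  (forall z, z != u -> z != v -> adj u z = adj v z) ->
  @adj (edge_pivot u v) x y = adj x y.
Proof.
move=> uv tw; rewrite edge_pivotE //; have vu : adj v u by rewrite adj_sym.
case: (eqVneq x y) => [->|xNy]; first by rewrite adj_irr.
case: (eqVneq x u) xNy => [->|xNu] xNy.
  by case: (eqVneq y v) => [->|yNv] //; rewrite tw // eq_sym.
case: (eqVneq x v) xNy => [->|xNv] xNy.
  by case: (eqVneq y u) => [->|yNu] //; rewrite tw // eq_sym.
have := tw _ xNu xNv; rewrite ![adj _ x]adj_sym => e.
case: (eqVneq y u) => [->|yNu]; first by rewrite e.
case: (eqVneq y v) => [->|yNv]; first by rewrite e.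
by rewrite e -(tw y) // addbK.
Qed.

End Feasible.

Lemma par_imset (H G : sgraph) (f : H -> G) (W : {set H}) (x : H) :
  injective f -> {mono f : x y / adj x y} -> par (f @: W) (f x) = par W x.
Proof.
move=> f_inj f_mono; rewrite /par -!big_mkcondr big_imset /=; last by move=> ? ? _ _ /f_inj.
by apply: eq_bigr => y _; rewrite f_mono.
Qed.

Lemma feasible_embed (H G : sgraph) (f : H -> G) (X : {set H}) :
  injective f -> {mono f : x y / adj x y} ->
  feasible X -> feasible (f @: X).
Proof.
move=> f_inj f_mono feasX W sWX parW.
have defW : W = f @: (f @^-1: W).
  apply/setP=> y; apply/idP/imsetP => [yW|[x]]; last by rewrite inE => ? ->.
  by have /imsetP [x xX yx] := subsetP sWX y yW; exists x; rewrite // inE -yx.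
rewrite defW; apply/eqP; rewrite imset_eq0; apply/eqP; apply: feasX.
  by apply/subsetP=> x; rewrite inE => /(subsetP sWX) /imsetP [z zX /f_inj ->].
by move=> x xX; rewrite -(par_imset _ _ f_inj f_mono) -defW parW // imset_f.
Qed.

(* Pivoting exchanges, at the coordinates u and v, the argument and the value of
   the linear map given by the adjacency matrix. *)
Lemma par_pivot (G : sgraph) (u v : G) (W : {set G}) (uv : adj u v) :
  let W' : {set edge_pivot u v} :=
    [set x | if x \in [set u; v] then par W x else x \in W] in
  forall x : G, par W' x = if x \in [set u; v] then x \in W else par W x.
Proof.
move=> W' x.
have uNv : u != v by apply: contraTneq uv => ->; rewrite adj_irr.
have vNu : v != u by rewrite eq_sym.
have vu : adj v u by rewrite adj_sym.
pose p : rel G := @adj (edge_pivot u v).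
have pE a b := edge_pivotE a b uv; rewrite -/p in pE.
have parE z : par W z = ((u \in W) && adj z u) (+) ((v \in W) && adj z v)
    (+) \big[addb/false]_(y | (y != u) && (y != v)) ((y \in W) && adj z y).
  by rewrite /par (bigD1 u) // (bigD1 v) //= addbA.
have -> : par W' x =
    (par W u && p x u)
    (+) (par W v && p x v)
    (+) \big[addb/false]_(y : G | (y != u) && (y != v))
          ((y \in W) && p x y).
  rewrite {1}/par (bigD1 (u : edge_pivot u v)) // (bigD1 (v : edge_pivot u v)) //=.
  rewrite addbA; congr (_ (+) _ (+) _); rewrite ?inE ?eqxx ?orbT //.
  by apply: eq_bigr => y /andP [yNu yNv]; rewrite !inE (negPf yNu) (negPf yNv).
move: p pE => p pE {W'}; set S := \big[addb/false]_(y | _) _.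
rewrite !inE; case: (eqVneq x u) => [xu|xNu] /=.
  have -> : S = \big[addb/false]_(y | (y != u) && (y != v)) ((y \in W) && adj v y).
    apply: eq_bigr => y /andP [yNu yNv]; rewrite pE xu eqxx eq_sym.
    by rewrite (negPf yNu) (negPf yNv).
  rewrite (parE v) xu !pE !eqxx (negPf uNv) adj_irr vu.
  set s := \big[addb/false]_(y | _) _; clearbody s.
  by case: s; case: (u \in W); case: (v \in W); case: (par W u).
case: (eqVneq x v) => [xv|xNv] /=.
  have -> : S = \big[addb/false]_(y | (y != u) && (y != v)) ((y \in W) && adj u y).
    apply: eq_bigr => y /andP [yNu yNv]; rewrite pE xv eqxx eq_sym.
    by rewrite (negPf yNu) (negPf yNv) (negPf vNu).
  rewrite (parE u) xv !pE !eqxx (negPf vNu) adj_irr uv.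
  set s := \big[addb/false]_(y | _) _; clearbody s.
  by case: s; case: (u \in W); case: (v \in W); case: (par W v).
have -> : S = \big[addb/false]_(y | (y != u) && (y != v)) ((y \in W) && adj x y)
  (+) (adj x u && \big[addb/false]_(y | (y != u) && (y != v)) ((y \in W) && adj v y))
  (+) (adj x v && \big[addb/false]_(y | (y != u) && (y != v)) ((y \in W) && adj u y)).
  rewrite !big_distrr -!big_split /=; apply: eq_bigr => y /andP [yNu yNv].
  rewrite pE (negPf xNu) (negPf xNv) (negPf yNu) (negPf yNv).
  case: (eqVneq x y) => [->|xNy]; last by case: (y \in W); rewrite ?andbF.
  rewrite adj_irr (adj_sym y u) (adj_sym y v).
  by case: (y \in W); case: (adj u y); case: (adj v y).
rewrite (parE x) (parE u) (parE v) !pE !eqxx (negPf xNu) (negPf xNv).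
rewrite !adj_irr uv vu (negPf vNu).
do 3![set s := \big[addb/false]_(y | _) _; move: s].
case: (u \in W); case: (v \in W); case: (adj x u); case: (adj x v).
all: by do 3![case].
Qed.

(** The exchange in [par_pivot] turns a kernel vector on [symdiff X [set u; v]] into a kernel vector
    [W'] of the pivoted graph on [X]. *)
Lemma feasible_pivot (G : sgraph) (u v : G) (X : {set G}) : adj u v ->
  @feasible (edge_pivot u v) X -> feasible (symdiff X [set u; v]).
Proof.
move=> uv feasX W sW parW.
pose W' : {set edge_pivot u v} :=
  [set x | if x \in [set u; v] then par W x else x \in W].
have parW' (x : G) : par W' x = if x \in [set u; v] then x \in W else par W x.
  exact: par_pivot.
have W'0 : W' = set0.
  apply: feasX.
    apply/subsetP=> x; rewrite inE; case: ifPn => [xT|xNT xW].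
      by move=> px; apply: contraTT px => xX; apply: parW; rewrite inE xT (negPf xX).
    by have := subsetP sW x xW; rewrite inE (negPf xNT) addbF.
  move=> x xX; rewrite parW'; case: ifPn => xT.
    by apply/negP => /(subsetP sW); rewrite inE xX xT.
  by apply: parW; rewrite inE xX (negPf xT).
(* At [u] and [v], membership in [W] is the value [par W'], which vanishes with [W']; elsewhere [W]
   and [W'] agree. *)
apply/setP=> x; rewrite in_set0; case: (boolP (x \in [set u; v])) => xT.
  have := parW' x; rewrite xT W'0 => <-.
  by rewrite /par big1 // => y _; rewrite inE.
by have := in_set0 x; rewrite -W'0 inE (negPf xT).
Qed.

Lemma feasible_true_twin (G : sgraph) (u v : G) (X : {set G}) : adj u v ->
  (forall z, z != u -> z != v -> adj u z = adj v z) ->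
  feasible X -> feasible (symdiff X [set u; v]).
Proof.
move=> uv tw feasX; apply: feasible_pivot => //.
rewrite -(imset_id X); apply: (@feasible_embed G (edge_pivot u v)) => //.
by move=> x y; apply: true_twin_pivot.
Qed.

(** * Feasible sets obtained from complete pivot-minors *)

(** Any two vertices of a complete graph are true twins, so [X] can be emptied two vertices at a
    time. *)
Lemma feasible_complete (G : sgraph) (X : {set G}) :
  (forall x y : G, adj x y = (x != y)) -> ~~ odd #|X| -> feasible X.
Proof.
move=> Gcomplete; have [n] := ubnP #|X|; elim: n X => // n IHn X leXn evX.
have [->|[x xX]] := set_0Vmem X; first exact: feasible0.
have [y /andP [yX xNy]] : exists y, (y \in X) && (x != y).
  apply/existsP; apply: contraNT evX => /existsPn noy.
  suff -> : X = [set x] by rewrite cards1.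
  apply/setP=> y; rewrite inE; apply/idP/eqP => [yX|-> //].
  by have := noy y; rewrite yX negbK => /eqP.
rewrite -(symdiffK X [set x; y]); apply: feasible_true_twin.
- by rewrite Gcomplete.
- by move=> z zNx zNy; rewrite !Gcomplete ![_ == z]eq_sym zNx zNy.
apply: IHn; last by rewrite odd_symdiff2.
by have := card_symdiff2 X xNy; rewrite xX yX /=; lia.
Qed.

(** Here [f] embeds the surviving vertices, and [X] accumulates the pivoted pairs; a deletion only
    adds an inclusion. *)
Lemma feasible_reachable (G G' : sgraph) : pivot_reachable G G' ->
  exists (f : G' -> G) (X : {set G}), injective f /\
    forall Z, feasible Z -> feasible (symdiff X (f @: Z)).
Proof.
elim=> {G G'} [G|G v G' _ [f [X [f_inj feasf]]]|G u v G' uv _ [f [X [f_inj feasf]]]].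
- exists id, set0; split=> // Z feasZ.
  by rewrite symdiffC symdiff0 imset_id.
- exists (fun x => val (f x)), (val @: X); split=> [x y /val_inj /f_inj //|Z feasZ].
  rewrite (imset_comp val f) -imset_symdiff; last exact: val_inj.
  apply: (@feasible_embed (delete_vertex v)) => //; first exact: val_inj.
  exact: feasf.
- exists f, (symdiff X [set u; v]); split=> // Z feasZ.
  by rewrite symdiffAC; apply: feasible_pivot => //; apply: feasf.
Qed.

(** [Y] is the set of vertices that survive in the complete graph, whose even sets are all
    feasible. *)
Lemma feasible_complete_minor (G : sgraph) (S : {set G}) n :
  has_pivot_minor (induced S) (complete_graph n) ->
  exists X Y : {set G}, [/\ X \subset S, Y \subset S, #|Y| = n &
    forall Z : {set G}, Z \subset Y -> ~~ odd #|Z| -> feasible (symdiff X Z)].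
Proof.
move=> [G' /feasible_reachable [f [X [f_inj feasf]]] [g [g' gK g'K] g_mono]].
have sub_val (A : {set induced S}) : val @: A \subset S.
  by apply/subsetP=> _ /imsetP [x _ ->]; apply: valP.
have vf_inj : injective (fun x => val (f x)) by move=> x y /val_inj /f_inj.
exists (val @: X), (val @: (f @: [set: G'])); split=> //.
  rewrite card_imset; last exact: val_inj.
  rewrite card_imset // cardsT -(card_ord n); apply: bij_eq_card.
  by exists g'; [apply: gK | apply: g'K].
rewrite -imset_comp => Z sZ evZ.
have defZ : Z = val @: (f @: [set x | val (f x) \in Z]).
  rewrite -imset_comp; apply/setP=> z; apply/idP/imsetP => [zZ|[x]].
    by have /imsetP [x _ zx] := subsetP sZ z zZ; exists x; rewrite // inE -[val _]zx.
  by rewrite inE => ? ->.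
rewrite defZ -imset_symdiff; last exact: val_inj.
apply: (@feasible_embed (induced S)) => //; first exact: val_inj.
apply/feasf/feasible_complete.
  by move=> x y; rewrite -g_mono /= /complete_adj (can_eq gK).
by move: evZ; rewrite {1}defZ -imset_comp card_imset.
Qed.

(** * Feasible sets in bipartite graphs *)

(* Otherwise, pigeonhole on the subsets of the larger colour class yields two
   vectors with the same image, and their sum is in the kernel. *)
Lemma feasible_bipartite_le (G : sgraph) (c : G -> bool) (X : {set G}) :
  {in X &, forall x y, adj x y -> c x != c y} -> feasible X ->
  #|[set x in X | c x]| <= #|[set x in X | ~~ c x]|.
Proof.
move=> bip feasX; rewrite leqNgt; apply/negP => lt_card.
pose im (W : {set G}) := [set x in X | ~~ c x & par W x].
pose C := [set x in X | c x].
have : ~~ [forall W1 in powerset C, forall W2 in powerset C,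
             (im W1 == im W2) ==> (W1 == W2)].
  apply/negP => /'forall_in_forall_inP inj_im.
  have inj : {in powerset C &, injective im}.
    by move=> W1 W2 W1C W2C /eqP e; apply/eqP; have := inj_im _ W1C _ W2C; rewrite e.
  have : #|im @: powerset C| <= #|powerset [set x in X | ~~ c x]|.
    apply/subset_leq_card/subsetP => _ /imsetP [W _ ->]; rewrite inE.
    by apply/subsetP=> x; rewrite !inE => /and3P [-> ->].
  by rewrite card_in_imset // !card_powerset leq_exp2l // leqNgt lt_card.
move=> /forall_inPn [W1]; rewrite inE => sW1 /forall_inPn [W2]; rewrite inE => sW2.
rewrite negb_imply => /andP [/eqP eq_im /eqP]; apply.
have /feasX W0 : symdiff W1 W2 \subset X.
  by apply: symdiff_sub; [apply: subset_trans sW1 _ | apply: subset_trans sW2 _];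
    apply/subsetP=> x; rewrite inE => /andP [].
rewrite -(symdiffK W1 W2) W0 ?(symdiffC set0) ?symdiff0 // => x xX.
case: (boolP (c x)) => cx.
  rewrite /par big1 // => y _; apply/negbTE/andP => [[yW xy]].
  have := subsetP (symdiff_sub sW1 sW2) y yW; rewrite inE => /andP [yX cy].
  by have := bip _ _ xX yX xy; rewrite cx cy.
by have /setP/(_ x) := eq_im; rewrite par_symdiff !inE xX cx /= => ->; rewrite addbb.
Qed.

(** The equation encodes that [X] meets both colour classes equally. In this form, toggling elements
    of [X] just toggles them in [symdiff X [set x | ~~ c x]], whose size must stay constant. *)
Lemma feasible_bipartite (G : sgraph) (c : G -> bool) (X : {set G}) :
  {in X &, forall x y, adj x y -> c x != c y} -> feasible X ->
  #|symdiff X [set x | ~~ c x]| = #|[set x | ~~ c x]|.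
Proof.
move=> bip feasX; pose c' x := ~~ c x.
have bip' : {in X &, forall x y, adj x y -> c' x != c' y}.
  by move=> x y xX yX /(bip _ _ xX yX); rewrite /c'; case: (c x); case: (c y).
have le1 := feasible_bipartite_le bip feasX.
have := feasible_bipartite_le bip' feasX; rewrite /c'.
have -> : [set x in X | ~~ ~~ c x] = [set x in X | c x].
  by apply/setP=> x; rewrite !inE negbK.
move=> le2.
rewrite -(cardsID [set x | c x]) -[RHS](cardsID X).
have -> : symdiff X [set x | ~~ c x] :&: [set x | c x] = [set x in X | c x].
  by apply/setP=> x; rewrite !inE; case: (c x); case: (x \in X).
have -> : symdiff X [set x | ~~ c x] :\: [set x | c x]
            = [set x | ~~ c x] :\: X.
  by apply/setP=> x; rewrite !inE; case: (c x); case: (x \in X).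
have -> : [set x | ~~ c x] :&: X = [set x in X | ~~ c x].
  by apply/setP=> x; rewrite !inE andbC.
by lia.
Qed.

Lemma feasible_bipartite_card (G : sgraph) (c : G -> bool) (B X Y : {set G}) :
  {in B &, forall x y, adj x y -> c x != c y} -> X \subset B -> Y \subset B ->
  feasible X ->
  {in Y &, forall x y, x != y -> feasible (symdiff X [set x; y])} -> #|Y| <= 2.
Proof.
move=> bip sXB sYB feasX feasXY.
have bipS (S : {set G}) : S \subset B ->
    {in S &, forall x y, adj x y -> c x != c y}.
  by move=> /subsetP sSB x y /sSB xB /sSB; apply: bip.
(* [g x] tells whether toggling [x] shrinks or enlarges the set of constant size; toggling two
   elements with the same effect would change that size by two. *)
pose g x := (x \in X) (+) ~~ c x.
have g_inj : {in Y &, injective g}.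
  move=> x y xY yY eq_g; apply/eqP; apply: contraT => xNy.
  have sB : symdiff X [set x; y] \subset B.
    by apply: symdiff_sub; rewrite // set2_sub // (subsetP sYB).
  have := feasible_bipartite (bipS _ sB) (feasXY _ _ xY yY xNy).
  have := feasible_bipartite (bipS _ sXB) feasX.
  rewrite symdiffAC => e1.
  have := card_symdiff2 (symdiff X [set z | ~~ c z]) xNy.
  move: eq_g; rewrite /g !inE => ->.
  by case: (_ (+) _) => /=; lia.
by rewrite -(card_in_imset g_inj) -card_bool; apply: max_card.
Qed.

(** * Twinned odd cycles and their proper induced subgraphs *)

(** The exceptional arc from 0 to 2, like the bound [i <= 1] in [closing_arc], gives 0 the
    neighbours of 1. *)
Definition path_arc (i j : nat) := (j == i.+1) || (i == 0) && (j == 2).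

Definition closing_arc n (i j : nat) := (i <= 1) && (j == n.-1).

(* The odd cycle 1, 2, ..., 2k + 3 in which 0 is a true twin of 1. *)
Definition twinned_cycle_adj k : rel 'I_(k.*2 + 4) := fun i j =>
  [|| path_arc i j, path_arc j i,
      closing_arc (k.*2 + 4) i j | closing_arc (k.*2 + 4) j i].

Lemma twinned_cycle_sym k : symmetric (@twinned_cycle_adj k).
Proof.
move=> i j; rewrite /twinned_cycle_adj orbCA; congr [|| _, _ | _].
by rewrite orbC.
Qed.

Lemma twinned_cycle_irr k : irreflexive (@twinned_cycle_adj k).
Proof. by move=> i; rewrite /twinned_cycle_adj /path_arc /closing_arc; lia. Qed.

Definition twinned_cycle k : sgraph :=
  SGraph (@twinned_cycle_sym k) (@twinned_cycle_irr k).

(* A 2-colouring of the cycle cut open at [d]; 0 gets the colour of 1. *)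
Definition twinned_cycle_color (d i : nat) := odd (maxn i 1) (+) (i < d).

(** Dropping the twin [a] leaves an odd cycle, which [d] cuts open. Parity fails only on the closing
    edge, and if that edge survives then its ends lie on different sides of [d]. *)
Lemma twinned_cycle_bipartite k (a d x y : twinned_cycle k) :
  a <= 1 -> d != a -> x != a -> y != a -> x != d -> y != d -> adj x y ->
  twinned_cycle_color d x != twinned_cycle_color d y.
Proof.
rewrite /= /twinned_cycle_adj /path_arc /closing_arc /twinned_cycle_color.
rewrite -!val_eqE /=.
case: a d x y => [a ?] [d ?] [x ?] [y ?] /= a1 dNa xNa yNa xNd yNd.
by case/or4P; lia.
Qed.

Lemma twinned_cycle_minor_free k (S : {set twinned_cycle k}) :
  S \proper [set: twinned_cycle k] ->
  ~ has_pivot_minor (induced S) (complete_graph 4).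
Proof.
move=> /properP [_ [w _ wS]] /feasible_complete_minor [X [Y [sXS sYS cardY feasXY]]].
(* It suffices to avoid one twin [a] and one further vertex [d] while keeping three elements to
   toggle. *)
have key (a d : twinned_cycle k) (X' Y' : {set twinned_cycle k}) :
    a <= 1 -> d != a -> a \notin X' :|: Y' -> d \notin X' :|: Y' -> feasible X' ->
    {in Y' &, forall x y, x != y -> feasible (symdiff X' [set x; y])} -> #|Y'| <= 2.
  move=> a1 dNa aN dN feasX'.
  pose c (x : twinned_cycle k) := twinned_cycle_color d x.
  apply: (@feasible_bipartite_card _ c (X' :|: Y'));
    rewrite ?subsetUl ?subsetUr // => x y xB yB.
  by apply: (twinned_cycle_bipartite a1 dNa);
     [apply: contraNneq aN | apply: contraNneq aN
     |apply: contraNneq dN | apply: contraNneq dN] => <-.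
(* Some even subset of [Y] moves [X] off any given [y] in [Y]. *)
have shift y : y \in Y -> exists X' : {set twinned_cycle k},
    [/\ X' \subset S :\ y, feasible X' &
      {in Y :\ y &, forall x z, x != z -> feasible (symdiff X' [set x; z])}].
  move=> yY; case: (boolP (y \in X)) => yX; last first.
    exists X; split.
    - by rewrite subsetD1 sXS.
    - by rewrite -(symdiff0 X); apply: feasXY; rewrite ?sub0set ?cards0.
    move=> x z /setD1P [_ xY] /setD1P [_ zY] xNz.
    by apply: feasXY; rewrite ?set2_sub // cards2 xNz.
  have [t /setD1P [tNy tY]] : exists t, t \in Y :\ y.
    by apply/set0Pn; rewrite -card_gt0; move: cardY; rewrite (cardsD1 y) yY; lia.
  exists (symdiff X [set t; y]); split.
  - rewrite subsetD1 symdiff_sub ?set2_sub ?(subsetP sYS) //.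
    by rewrite !inE yX eqxx orbT.
  - by apply: feasXY; rewrite ?set2_sub // cards2 tNy.
  move=> x z /setD1P [_ xY] /setD1P [_ zY] xNz; rewrite -symdiffA.
  apply: feasXY; first by rewrite symdiff_sub ?set2_sub.
  by rewrite odd_symdiff2 // cards2 tNy.
have cardY1 y : y \in Y -> #|Y :\ y| = 3.
  by move=> yY; move: cardY; rewrite (cardsD1 y) yY; lia.
have notinU y (X' : {set twinned_cycle k}) :
    X' \subset S :\ y -> y \notin X' :|: Y :\ y.
  by rewrite subsetD1 => /andP [_ yX']; rewrite !inE eqxx /= orbF.
have wU y (X' : {set twinned_cycle k}) :
    X' \subset S :\ y -> w \notin X' :|: Y :\ y.
  rewrite subsetD1 => /andP [sX'S _]; apply: contra wS; rewrite in_setU.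
  by case/orP => [/(subsetP sX'S)|/setD1P [_ /(subsetP sYS)]].
(* If the missing vertex [w] is a twin, it serves as [a], and any [y] in [Y] can be freed to serve
   as [d]. Otherwise [w] serves as [d], and a twin has to be freed. *)
case: (leqP w 1) => w1.
  have [y yY] : exists y, y \in Y by apply/set0Pn; rewrite -card_gt0 cardY.
  have [X' [sX' feasX' feasX'Y]] := shift y yY.
  have yNw : y != w by apply: contraNneq wS => <-; apply: subsetP yY.
  have := key w y X' _ w1 yNw (wU _ _ sX') (notinU _ _ sX') feasX' feasX'Y.
  by rewrite cardY1.
have wNle (a : twinned_cycle k) : a <= 1 -> w != a.
  by move=> a1; apply: contraTneq w1 => ->; rewrite -leqNgt.
(* A twin in [Y] could be freed by [shift], at the cost of one of the four elements of [Y]. *)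
have noY (a : twinned_cycle k) : a <= 1 -> a \notin Y.
  move=> a1; apply/negP => aY; have [X' [sX' feasX' feasX'Y]] := shift a aY.
  by have := key a w X' _ a1 (wNle a a1) (notinU _ _ sX') (wU _ _ sX') feasX' feasX'Y;
     rewrite cardY1.
(* As [Y] contains no twin, a set [X'] missing a twin would already give the contradiction with all
   of [Y]. *)
have noX (a : twinned_cycle k) (X' : {set twinned_cycle k}) :
    a <= 1 -> a \notin X' -> w \notin X' -> feasible X' ->
    ~ {in Y &, forall x y, x != y -> feasible (symdiff X' [set x; y])}.
  move=> a1 aX' wX' feasX' /(key a w X' Y a1 (wNle a a1)).
  rewrite cardY !in_setU !negb_or aX' noY // wX' /=.
  by rewrite (contra (subsetP sYS w)) // => /(_ isT isT feasX').
have lt0 : 0 < k.*2 + 4 by lia.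
have lt1 : 1 < k.*2 + 4 by lia.
pose v0 : twinned_cycle k := Ordinal lt0; pose v1 : twinned_cycle k := Ordinal lt1.
have wX : w \notin X by apply: contra wS; apply: subsetP.
have feasX : feasible X.
  by rewrite -(symdiff0 X); apply: feasXY; rewrite ?sub0set ?cards0.
have feasX2 : {in Y &, forall x y, x != y -> feasible (symdiff X [set x; y])}.
  by move=> x y xY yY xNy; apply: feasXY; rewrite ?set2_sub // cards2 xNy.
case: (boolP (v0 \in X)) => v0X; last exact: (noX v0 X).
case: (boolP (v1 \in X)) => v1X; last exact: (noX v1 X).
have twin (X' : {set twinned_cycle k}) :
    feasible X' -> feasible (symdiff X' [set v0; v1]).
  apply: feasible_true_twin => // z.
  rewrite /= /twinned_cycle_adj /path_arc /closing_arc -!val_eqE /=.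
  by case: z => [z ?] /=; lia.
(* Both twins lie in [X]; toggling them together frees [v0], and commutes with toggling pairs of
   [Y]. *)
apply: (noX v0 (symdiff X [set v0; v1])) => //.
- by rewrite !inE v0X eqxx.
- by rewrite in_symdiff (negPf wX) !inE -!val_eqE /=; lia.
- exact: twin.
by move=> x y xY yY xNy; rewrite symdiffAC; apply/twin/feasX2.
Qed.

(** * Shortening a twinned cycle to the complete graph on four vertices *)

Lemma delete_vertex_embed (H G : sgraph) (f : H -> G) (v : G) :
  injective f -> {mono f : x y / adj x y} -> (forall x, f x != v) ->
  exists g : H -> delete_vertex v,
    [/\ injective g, {mono g : x y / adj x y} & forall x, val (g x) = f x].
Proof.
move=> f_inj f_mono fNv.
have fC x : f x \in [set~ v] by rewrite !inE fNv.
exists (fun x => Sub (f x) (fC x)); split=> [x y /(congr1 val) /f_inj //|x y|//].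
exact: f_mono.
Qed.

Lemma card_delete_vertex (G : sgraph) (v : G) : #|delete_vertex v| = #|G|.-1.
Proof. by rewrite card_sig cardsC1. Qed.

(** The last two vertices [n] and [n.+1] of the longer cycle are pivoted and deleted. Outside this
    edge, [n] sees only [n.-1] and [n.+1] sees only the twins, so the pivot creates exactly the
    closing edges of the shorter cycle. Deletion passes to subtypes, hence the induction over all
    isomorphic copies [G]. *)
Lemma twinned_cycle_minor k (G : sgraph) :
  isomorphic (twinned_cycle k) G -> has_pivot_minor G (complete_graph 4).
Proof.
elim: k G => [|k IHk] G [f f_bij f_mono].
  exists G; first exact: pivot_reachable_refl.
  case: f_bij => g fK gK; exists g; first by exists f.
  move=> x y; rewrite -{2}[x]gK -{2}[y]gK f_mono /= /complete_adj.
  rewrite /twinned_cycle_adj /path_arc /closing_arc -val_eqE /=.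
  by case: (g x) (g y) => [a ?] [b ?] /=; lia.
have f_inj := bij_inj f_bij; set n := k.*2 + 4.
have ltn0 : n < k.+1.*2 + 4 by lia.
have ltn1 : n.+1 < k.+1.*2 + 4 by lia.
have lew : n <= k.+1.*2 + 4 by lia.
pose u := f (Ordinal ltn0); pose v := f (Ordinal ltn1).
pose h (i : twinned_cycle k) : edge_pivot u v := f (widen_ord lew i).
have uv : adj u v by rewrite f_mono /= /twinned_cycle_adj /path_arc /closing_arc /=; lia.
have h_inj : injective h by move=> i j /f_inj /(congr1 val) /= /val_inj.
have hNu i : h i != u.
  by rewrite (inj_eq f_inj) -val_eqE /=; case: i => [i ?] /=; lia.
have hNv i : h i != v.
  by rewrite (inj_eq f_inj) -val_eqE /=; case: i => [i ?] /=; lia.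
have h_mono : {mono h : x y / adj x y}.
  move=> i j; rewrite edge_pivotE // (inj_eq h_inj).
  rewrite !(negPf (hNu _)) !(negPf (hNv _)).
  case: eqVneq => [->|iNj]; first by rewrite adj_irr.
  rewrite /h /u /v !f_mono /= /twinned_cycle_adj /=.
  move: iNj; rewrite -val_eqE /=; case: i j => [i lt_in] [j lt_jn] /= iNj.
  have pathn a : a < n -> (path_arc a n = (a == n.-1)) * (path_arc n a = false)
      * (path_arc a n.+1 = false) * (path_arc n.+1 a = false).
    by rewrite /path_arc => lt_an; do !split; lia.
  have closn a : a < n ->
      (closing_arc (k.+1.*2 + 4) a n.+1 = (a <= 1))
      * (closing_arc (k.+1.*2 + 4) n.+1 a = false)
      * (closing_arc (k.+1.*2 + 4) a n = false)
      * (closing_arc (k.+1.*2 + 4) n a = false)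
      * (forall b, closing_arc (k.+1.*2 + 4) b a = false).
    by rewrite /closing_arc => lt_an; do !split; move=> *; lia.
  rewrite !(pathn i, pathn j, closn i, closn j) //= !orbF.
  (* Old path edges and new closing edges are disjoint, and no pair closes in both directions, so
     the exclusive sums from the pivot agree with the disjunctions defining the shorter cycle. *)
  have : ~~ (path_arc i j || path_arc j i) || ~~ (closing_arc n i j || closing_arc n j i).
    by rewrite /path_arc /closing_arc; lia.
  have : ~~ (closing_arc n i j && closing_arc n j i).
    by rewrite /closing_arc; lia.
  rewrite orbA -/n /closing_arc ![_ && (_ <= 1)]andbC.
  by case: ((i <= 1) && _); case: ((j <= 1) && _); case: (path_arc i j || _).
have [g [g_inj g_mono valg]] := delete_vertex_embed h_inj h_mono hNv.
have uC : u \in [set~ v].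
  by rewrite !inE; apply: contraTneq uv => ->; rewrite adj_irr.
pose u' : @delete_vertex (edge_pivot u v) v := Sub u uC.
have gNu i : g i != u' by rewrite -val_eqE valg hNu.
have [g' [g'_inj g'_mono _]] := delete_vertex_embed g_inj g_mono gNu.
have [|G' G'reach G'iso] := IHk (delete_vertex u').
  (* Exactly two vertices were removed, so the embedding is onto by counting. *)
  exists g' => //; apply: inj_card_bij => //.
  rewrite !card_delete_vertex -(bij_eq_card f_bij) !card_ord; lia.
exists G' => //; apply: (pivot_reachable_pivot uv).
by apply: (@pivot_reachable_delete (edge_pivot u v) v); apply: pivot_reachable_delete G'reach.
Qed.

Theorem proposition6p1 :
  infinitely_many_nonisomorphic (minimal_family (complete_graph 4)).
Proof.
exists twinned_cycle; split=> [k|i j iNj [f f_bij _]].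
  split; last exact: twinned_cycle_minor_free.
  by apply: (@twinned_cycle_minor k); exists id => //; exists id.
by have := bij_eq_card f_bij; rewrite !card_ord; lia.
Qed.
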